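(* Let $k\ge1$. Every affine permutation $x\in\tilde S_{k+1}$ has a unique maximal decomposition into cyclically decreasing elements: among all sequences $(A_1,\dots,A_n)$ of nonempty proper subsets of $I$ with $x=d_{A_n}d_{A_{n-1}}\cdots d_{A_1}$ in the affine nil-Coxeter monoid, there is exactly one whose shape $(|A_1|,|A_2|,\dots,|A_n|)$ is lexicographically maximal.
   Context: Fix $k\ge1$ and let $I=\mathbb Z/(k+1)\mathbb Z$ (indices are taken mod $k+1$). $\tilde S_{k+1}$ is the group of bijections $x:\mathbb Z\to\mathbb Z$ with $x(i+k+1)=x(i)+k+1$ and $\sum_{i=1}^{k+1}x(i)=\binom{k+2}{2}$, generated by $s_i$ ($i\in I$), where $s_i$ exchanges $m(k+1)+i$ and $m(k+1)+i+1$ for all $m\in\mathbb Z$. The affine nil-Coxeter monoid $\hat{\mathbb A}_k$ is generated by $a_i$ ($i\in I$) and an absorbing zero $0$, with relations $a_i^2=0$, $a_ia_j=a_ja_i$ for $j\notin\{i-1,i,i+1\}$, and (for $k\ge2$) $a_ia_{i+1}a_i=a_{i+1}a_ia_{i+1}$. Nonzero elements of $\hat{\mathbb A}_k$ are identified with affine permutations by sending $a_{w_1}\cdots a_{w_l}$ to $s_{w_1}\cdots s_{w_l}$ for reduced words; a product $xy$ in $\hat{\mathbb A}_k$ is nonzero iff lengths add. For $A\subsetneq I$, the cyclically decreasing element $d_A$ is the product of the $a_i$, $i\in A$, each occurring once, ordered so that whenever $j,j-1\in A$ the letter $a_j$ is to the left of $a_{j-1}$ (this is well defined). *)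

(* Defs.v *)
From mathcomp Require Import all_boot all_order all_algebra.
Set Implicit Arguments.
Unset Strict Implicit.
Unset Printing Implicit Defensive.

Import Order.TTheory GRing.Theory Num.Theory.

Local Open Scope ring_scope.

(* The index set I = Z/(k+1)Z is 'I_k.+1; ordS and ord_pred are i |-> i + 1
   and i |-> i - 1 modulo k + 1. *)

Definition affine_perm (k : nat) (x : int -> int) : Prop :=
  [/\ bijective x,
      forall i : int, x (i + k.+1%:Z) = x i + k.+1%:Z
    & \sum_(1 <= i < k.+2) x i%:Z = ('C(k.+2, 2))%:Z].

Definition affine_refl (k : nat) (i : 'I_k.+1) (z : int) : int :=
  if (z == i%:Z %[mod k.+1%:Z])%Z then z + 1
  else if (z == i%:Z + 1 %[mod k.+1%:Z])%Z then z - 1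
  else z.

(* The product in the group of affine permutations is composition of maps,
   (x y)(z) = x (y z). *)
Definition word_perm (k : nat) (w : seq 'I_k.+1) : int -> int :=
  foldr (fun i f => affine_refl i \o f) id w.

Definition reduced_word (k : nat) (x : int -> int) (w : seq 'I_k.+1) : Prop :=
  word_perm w =1 x /\
  forall v : seq 'I_k.+1, word_perm v =1 x -> (size w <= size v)%N.

(* The free monoid on the a_i with an absorbing zero adjoined: Some w is the
   product of the a_i along the word w, and None is the zero. *)
Definition word0 (k : nat) := option (seq 'I_k.+1).

Definition mul0 (k : nat) (u v : word0 k) : word0 k :=
  if u is Some u' then if v is Some v' then Some (u' ++ v') else None
  else None.

(* Equality in the affine nil-Coxeter monoid: the smallest congruence on
   word0 k containing the defining relations. *)
Inductive nil_eq (k : nat) : word0 k -> word0 k -> Prop :=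
| nil_eq_refl u : nil_eq u u
| nil_eq_sym u v : nil_eq u v -> nil_eq v u
| nil_eq_trans u v w : nil_eq u v -> nil_eq v w -> nil_eq u w
| nil_eq_mul u u' v v' :
    nil_eq u u' -> nil_eq v v' -> nil_eq (mul0 u v) (mul0 u' v')
| nil_eq_square (i : 'I_k.+1) : nil_eq (Some [:: i; i]) None
| nil_eq_comm (i j : 'I_k.+1) :
    j \notin [:: ord_pred i; i; ordS i] ->
    nil_eq (Some [:: i; j]) (Some [:: j; i])
| nil_eq_braid (i : 'I_k.+1) : (2 <= k)%N ->
    nil_eq (Some [:: i; ordS i; i]) (Some [:: ordS i; i; ordS i]).

(* The element of the nil-Coxeter monoid represented by u is the one identified
   with the affine permutation x. *)
Definition represents (k : nat) (u : word0 k) (x : int -> int) : Prop :=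
  exists w : seq 'I_k.+1, reduced_word x w /\ nil_eq (Some w) u.

Definition cyc_decreasing (k : nat) (A : {set 'I_k.+1}) (w : seq 'I_k.+1) :
    bool :=
  perm_eq w (enum A) &&
  [forall j in A, (ord_pred j \in A) ==>
     (index j w < index (ord_pred j) w)%N].

(* Some cyclically decreasing word on A.  For A <> I there is one, and all of
   them are equal in the monoid: see cyc_wordP and cyc_decreasing_nil_eq. *)
Definition cyc_word (k : nat) (A : {set 'I_k.+1}) : seq 'I_k.+1 :=
  head [::] [seq w <- permutations (enum A) | cyc_decreasing A w].

Definition cyc_elt (k : nat) (A : {set 'I_k.+1}) : word0 k :=
  Some (cyc_word A).

(* s = [:: A_1; ...; A_n] stands for the product d_{A_n} ... d_{A_1}. *)
Definition cyc_decomposition (k : nat) (x : int -> int)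
    (s : seq {set 'I_k.+1}) : Prop :=
  all (fun A : {set 'I_k.+1} => (A != set0) && (A != setT)) s /\
  represents (\big[@mul0 k/Some [::]]_(A <- rev s) cyc_elt A) x.

Definition shape (k : nat) (s : seq {set 'I_k.+1}) : seqlexi nat :=
  [seq #|A| | A : {set 'I_k.+1} <- s].

Definition maximal_cyc_decomposition (k : nat) (x : int -> int)
    (s : seq {set 'I_k.+1}) : Prop :=
  cyc_decomposition x s /\
  forall t : seq {set 'I_k.+1}, cyc_decomposition x t ->
    (shape t <= shape s)%O.

Lemma index_filter_lt (T : eqType) (P : pred T) (s : seq T) (x y : T) :
  P x -> P y -> (index x s < index y s)%N ->
  (index x (filter P s) < index y (filter P s))%N.
Proof.
move=> Px Py; elim: s => [|a s IH] //=.
have [ax|nax] := eqVneq a x.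
  case: (eqVneq a y) => [|nay] //= _.
  by rewrite ax Px /= eqxx -ax (negPf nay).
have [ay|nay] := eqVneq a y; first by [].
rewrite ltnS => /IH lt; case: (P a) => //=.
by rewrite (negPf nax) (negPf nay) ltnS.
Qed.

Lemma cyc_decreasing_exists (k : nat) (A : {set 'I_k.+1}) :
  A != setT -> exists w, cyc_decreasing A w.
Proof.
move=> AT.
have [i iA] : exists i, i \notin A.
  apply/existsP; rewrite -negb_forall; apply: contra AT => /forallP h.
  by apply/eqP/setP => j; rewrite h in_setT.
pose f (j : 'I_k.+1) : nat := ((j + (k.+1 - i)) %% k.+1)%N.
have fi : f i = 0%N by rewrite /f subnKC ?modnn // ltnW.
have ltf (j : 'I_k.+1) : (f j < k.+1)%N by rewrite ltn_mod.
have finj : injective f.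
  move=> a b /eqP; rewrite eqn_modDr !modn_small // => /eqP e.
  exact: val_inj.
have fpred (j : 'I_k.+1) : j != i -> f j = (f (ord_pred j)).+1.
  move=> ji; set p := ord_pred j; have jE : j = ordS p by rewrite ord_predK.
  have e : f j = ((f p).+1 %% k.+1)%N.
    by rewrite jE /f /= modnDml addSn -addn1 -[in RHS]addn1 modnDml.
  have := ltf p; rewrite leq_eqVlt => /orP[/eqP[fp]|lt]; last first.
    by rewrite e modn_small.
  case/eqP: ji; apply: finj; rewrite fi e fp modnn //.
pose r := sort (fun a b : 'I_k.+1 => (f b <= f a)%N) (enum 'I_k.+1).
have tot : total (fun a b : 'I_k.+1 => (f b <= f a)%N).
  by move=> a b; exact: leq_total.
have tr : transitive (fun a b : 'I_k.+1 => (f b <= f a)%N).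
  by move=> a b c h1 h2; exact: leq_trans h2 h1.
have rs := sort_sorted tot (enum 'I_k.+1).
have rm a : a \in r by rewrite mem_sort mem_enum.
have ru : uniq r by rewrite sort_uniq; apply: enum_uniq.
exists [seq a <- r | a \in A]; apply/andP; split.
  apply: uniq_perm; [exact: filter_uniq | exact: enum_uniq |].
  by move=> a; rewrite mem_filter rm andbT mem_enum.
apply/forall_inP => j jA; apply/implyP => pA.
apply: index_filter_lt => //.
rewrite ltnNge; apply/negP => le.
have := sorted_leq_index tr (fun a => leqnn (f a)) rs _ _ (rm _) (rm _) le.
rewrite (fpred j) ?ltnn //.
by apply: contraNneq iA => <-.
Qed.

Lemma cyc_wordP (k : nat) (A : {set 'I_k.+1}) :
  A != setT -> cyc_decreasing A (cyc_word A).
Proof.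
move=> /cyc_decreasing_exists[w Hw]; rewrite /cyc_word.
set s := filter _ _.
have ws : w \in s.
  by rewrite mem_filter Hw mem_permutations; case/andP: Hw.
have : head [::] s \in s by case: s ws => //= a s _; rewrite mem_head.
by rewrite mem_filter => /andP[].
Qed.

Lemma nil_eq_cat (k : nat) (u u' v v' : seq 'I_k.+1) :
  nil_eq (Some u) (Some u') -> nil_eq (Some v) (Some v') ->
  nil_eq (Some (u ++ v)) (Some (u' ++ v')).
Proof. exact: nil_eq_mul. Qed.

Lemma nil_eq_move (k : nat) (a : 'I_k.+1) (v : seq 'I_k.+1) :
  {in v, forall b, a \notin [:: ord_pred b; b; ordS b]} ->
  nil_eq (Some (v ++ [:: a])) (Some (a :: v)).
Proof.
elim: v => [|b v IH] h /=; first exact: nil_eq_refl.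
apply: (nil_eq_trans (v := Some ([:: b] ++ a :: v))).
  apply: (@nil_eq_cat _ [:: b] [:: b]); first exact: nil_eq_refl.
  by apply: IH => c cv; apply: h; rewrite in_cons cv orbT.
apply: (@nil_eq_cat _ [:: b; a] [:: a; b]); last exact: nil_eq_refl.
by apply: nil_eq_comm; apply: h; rewrite mem_head.
Qed.

Lemma nil_eq_trace (k : nat) (u v : seq 'I_k.+1) :
  uniq u -> perm_eq u v ->
  {in u &, forall a b, a \in [:: ord_pred b; b; ordS b] ->
     (index a u < index b u)%N -> (index a v < index b v)%N} ->
  nil_eq (Some u) (Some v).
Proof.
elim: u v => [|a u IH] v uu uv h.
  by move: uv; rewrite perm_sym => /perm_nilP->; exact: nil_eq_refl.
have av : a \in v by rewrite -(perm_mem uv) mem_head.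
have vu : uniq v by rewrite -(perm_uniq uv).
case/splitPr: av uv vu h => v1 v2 uv vu h.
have uv' : perm_eq u (v1 ++ v2).
  by rewrite -(perm_cons a) (perm_trans uv) // -cat1s perm_catCA.
have [av1 av2] : a \notin v1 /\ a \notin v2.
  move: vu; rewrite cat_uniq /= negb_or.
  by case/and3P=> _ /andP[-> _] /andP[-> _].
case/andP: (uu) => au uu'.
apply: (nil_eq_trans (v := Some (a :: v1 ++ v2))).
  apply: (@nil_eq_cat _ [:: a] [:: a]); first exact: nil_eq_refl.
  apply: IH => // b c bu cu bc lt.
  have [ab ac] : a != b /\ a != c.
    by split; apply: contraNneq au => ->.
  have := h b c; rewrite !inE bu cu !orbT /= => /(_ isT isT).
  rewrite !inE in bc; rewrite bc (negPf ab) (negPf ac) ltnS => /(_ isT lt).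
  rewrite !index_cat /= (negPf ab) (negPf ac).
  case: (boolP (b \in v1)) => b1; case: (boolP (c \in v1)) => c1 //.
  - by move=> _; apply: ltn_addr; rewrite index_mem.
  - move=> l; exfalso; move: l; rewrite ltnNge => /negP; apply.
    by apply: leq_trans (leq_addr _ _); rewrite ltnW // index_mem.
  - by rewrite !addnS ltnS.
apply: nil_eq_sym; rewrite -cat_rcons -cats1 -cat_cons.
apply: nil_eq_cat; last exact: nil_eq_refl.
apply: nil_eq_move => b b1; apply/negP => bad.
have ab : a != b by apply: contraNneq av1 => ->.
have bu : b \in u by rewrite (perm_mem uv') mem_cat b1.
have := h a b; rewrite !inE eqxx bu orbT /= => /(_ isT isT).
rewrite !inE in bad; rewrite bad (negPf ab) eqxx => /(_ isT isT).
by rewrite !index_cat b1 (negPf av1) /= eqxx addn0 ltnNge ltnW // index_mem.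
Qed.

Lemma cyc_decreasing_nil_eq (k : nat) (A : {set 'I_k.+1})
    (u v : seq 'I_k.+1) :
  cyc_decreasing A u -> cyc_decreasing A v -> nil_eq (Some u) (Some v).
Proof.
move=> /andP[pu /forall_inP hu] /andP[pv /forall_inP hv].
have mu a : (a \in u) = (a \in A) by rewrite (perm_mem pu) mem_enum.
apply: nil_eq_trace.
- by rewrite (perm_uniq pu) enum_uniq.
- by rewrite (perm_trans pu) // perm_sym.
move=> a b; rewrite !mu => aA bA; rewrite !inE => /or3P[] /eqP e; subst a.
- have := implyP (hu b bA) aA => /ltnW; rewrite leqNgt => /negPf->.
  by [].
- by rewrite ltnn.
- by move=> _; have := implyP (hv _ aA); rewrite ordSK => /(_ bA).
Qed.

(* Main.v *)
(* Write n = k + 1 and call r a record of x when x(q) < x(r) for all q < r.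
   Right multiplication by the inverse of a cyclically decreasing d_A moves, for
   each run i, ..., j of A, the value x(i) past x(i+1), ..., x(j+1); this lowers
   the length by |A| exactly when x(i) exceeds all of these.  Hence no element of
   A + 1 is a record when d_A is a right factor of x, and conversely
   M = {j | j + 1 is not a record} gives a right factor d_M: each run of M is
   preceded by a record, which dominates up to the next record.  So all admissible
   A_1 are subsets of M, the lexicographic maximum is reached only by A_1 = M, and
   one concludes by induction on the length of x. *)

Require Import Defs.
From mathcomp Require Import all_boot all_order all_algebra.
From mathcomp Require Import zify ring.

Set Implicit Arguments.
Unset Strict Implicit.
Unset Printing Implicit Defensive.

Import Order.TTheory GRing.Theory Num.Theory.

Local Open Scope ring_scope.

(** * Residues modulo k + 1 *)

Definition residue (k : nat) (z : int) : 'I_k.+1 :=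
  inord `|(z %% k.+1%:Z)%Z|%N.

Lemma residue_val (k : nat) (z : int) :
  (residue k z : nat)%:Z = (z %% k.+1%:Z)%Z.
Proof.
have h0 : 0 <= (z %% k.+1%:Z)%Z by exact: modz_ge0.
have h1 : (z %% k.+1%:Z)%Z < k.+1%:Z by exact: ltz_pmod.
by rewrite inordK ?gez0_abs //; lia.
Qed.

Lemma residue_eq (k : nat) (z : int) (i : 'I_k.+1) :
  (residue k z == i) = (z == i%:Z %[mod k.+1%:Z])%Z.
Proof.
rewrite (modz_small (m := i%:Z)) /= ?ltz_nat ?ltn_ord // -residue_val.
exact: val_eqE.
Qed.

Lemma residue_ord (k : nat) (i : 'I_k.+1) : residue k i%:Z = i.
Proof. by apply/eqP; rewrite residue_eq. Qed.

Lemma residueS (k : nat) (z : int) : residue k (z + 1) = ordS (residue k z).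
Proof.
apply: val_inj => /=; apply/eqP; rewrite -eqz_nat residue_val.
by rewrite -modz_nat -[(residue k z).+1]addn1 PoszD residue_val modzDml.
Qed.

Lemma residue_pred (k : nat) (z : int) :
  residue k (z - 1) = ord_pred (residue k z).
Proof. by rewrite -{2}[z](subrK 1) residueS ordSK. Qed.

Lemma residue_shift (k : nat) (z t : int) :
  residue k (z + t * k.+1%:Z) = residue k z.
Proof. by apply/eqP; rewrite residue_eq residue_val modz_mod addrC modzMDl. Qed.

Lemma residue_period (k : nat) (z : int) :
  residue k (z + k.+1%:Z) = residue k z.
Proof. by rewrite -{1}[k.+1%:Z]mul1r residue_shift. Qed.

Lemma residue_eqP (k : nat) (y z : int) :
  residue k y = residue k z -> exists t : int, y = z + t * k.+1%:Z.
Proof.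
move=> e; exists ((y %/ k.+1%:Z)%Z - (z %/ k.+1%:Z)%Z).
have := divz_eq y k.+1%:Z; have := divz_eq z k.+1%:Z.
by rewrite -!residue_val e mulrBl; lia.
Qed.

Lemma ordS_neq (k : nat) (i : 'I_k.+1) : (1 <= k)%N -> ordS i != i.
Proof.
move=> hk; rewrite -val_eqE /=; have := ltn_ord i.
rewrite ltnS leq_eqVlt => /orP[/eqP->|lt]; first by rewrite modnn; lia.
by rewrite modn_small ?ltnS //; lia.
Qed.

Lemma ordSS_neq (k : nat) (i : 'I_k.+1) : (2 <= k)%N -> ordS (ordS i) != i.
Proof.
move=> hk; rewrite -val_eqE /=; have := ltn_ord i.
rewrite ltnS leq_eqVlt => /orP[/eqP->|lt]; last first.
  rewrite (modn_small (m := i.+1)) ?ltnS //.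
  move: lt; rewrite leq_eqVlt => /orP[/eqP e|lt]; first by rewrite e modnn; lia.
  by rewrite modn_small ?ltnS //; lia.
rewrite modnn modn_small //; lia.
Qed.

(** * Periodic maps and the action of simple reflections *)

Definition periodic (k : nat) (x : int -> int) : Prop :=
  forall z : int, x (z + k.+1%:Z) = x z + k.+1%:Z.

Lemma periodic_shift (k : nat) (x : int -> int) (z t : int) :
  periodic k x -> x (z + t * k.+1%:Z) = x z + t * k.+1%:Z.
Proof.
move=> px; elim/int_ind: t => [|m IH|m IH]; first by rewrite !mul0r !addr0.
  by rewrite -addn1 PoszD mulrDl mul1r !addrA px IH.
have := px (z + - (m.+1)%:Z * k.+1%:Z).
rewrite -addrA -[X in _ + (_ + X)]mul1r -mulrDl.
have -> : - (m.+1)%:Z + 1 = - m%:Z by lia.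
move=> e; apply: (addIr k.+1%:Z); rewrite -e IH; lia.
Qed.

Lemma affine_reflE (k : nat) (i : 'I_k.+1) (z : int) :
  affine_refl i z = if residue k z == i then z + 1
                    else if residue k z == ordS i then z - 1 else z.
Proof.
rewrite /affine_refl residue_eq.
have -> // : (z == i%:Z + 1 %[mod k.+1%:Z])%Z = (residue k z == ordS i).
by rewrite -[in RHS](residue_ord i) -residueS -!val_eqE /= -eqz_nat !residue_val.
Qed.

Lemma affine_refl_periodic (k : nat) (i : 'I_k.+1) : periodic k (affine_refl i).
Proof.
move=> z; rewrite !affine_reflE residue_period.
by case: ifP => _; [|case: ifP => _]; rewrite // addrAC.
Qed.

Lemma affine_reflK (k : nat) (i : 'I_k.+1) :
  (1 <= k)%N -> involutive (affine_refl i).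
Proof.
move=> hk z; rewrite (affine_reflE i z).
case: eqP => [zi|zi].
  by rewrite affine_reflE residueS zi (negPf (ordS_neq i hk)) eqxx addrK.
case: eqP => [zi'|zi'].
  by rewrite affine_reflE residue_pred zi' ordSK eqxx subrK.
by rewrite affine_reflE; case: eqP => // _; case: eqP.
Qed.

Lemma word_perm_cat (k : nat) (u v : seq 'I_k.+1) :
  word_perm (u ++ v) =1 word_perm u \o word_perm v.
Proof. by elim: u => //= i u IH z /=; rewrite IH. Qed.

Lemma word_perm_rcons (k : nat) (w : seq 'I_k.+1) (i : 'I_k.+1) :
  word_perm (rcons w i) =1 word_perm w \o affine_refl i.
Proof. by rewrite -cats1; exact: word_perm_cat. Qed.

Lemma word_perm_periodic (k : nat) (w : seq 'I_k.+1) : periodic k (word_perm w).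
Proof. by elim: w => //= i w IH z /=; rewrite IH affine_refl_periodic. Qed.

Lemma word_perm_inj (k : nat) (w : seq 'I_k.+1) :
  (1 <= k)%N -> injective (word_perm w).
Proof.
move=> hk; elim: w => [|i w IH] //=.
by apply: inj_comp => //; exact: inv_inj (affine_reflK _ hk).
Qed.

(** A reflection moves each integer by at most 1, so the order of a < b is reversed only if a goes
    up, b goes down and they are neighbours. *)
Lemma affine_refl_flip (k : nat) (i : 'I_k.+1) (a b : int) :
  a < b -> affine_refl i b < affine_refl i a -> residue k a = i /\ b = a + 1.
Proof.
move=> ab; rewrite !affine_reflE.
case: (residue k a =P i) => ai; case: (residue k b =P i) => bi;
  case: (residue k b =P ordS i) => bi'; case: (residue k a =P ordS i) => ai' h;
  by [split=> //; lia | exfalso; lia].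
Qed.

(** Conjugating s_i by u exchanges u(p) and u(p+1) and their translates; as these values are
    adjacent, the result is s_j. This yields the exchange property, the commutations and the braid
    relation. *)
Lemma affine_refl_conj (k : nat) (i j : 'I_k.+1) (u : int -> int) (p : int) :
  periodic k u -> injective u -> residue k p = i ->
  residue k (u p) = j -> u (p + 1) = u p + 1 ->
  affine_refl j \o u =1 u \o affine_refl i.
Proof.
move=> pu iu pi uj up z /=; rewrite !affine_reflE.
case: (residue k z =P i) => [zi|zi].
  have [t ->] : exists t, z = p + t * k.+1%:Z by apply: residue_eqP; rewrite pi.
  by rewrite addrAC !periodic_shift // residue_shift uj eqxx up; lia.
case: (residue k (u z) =P j) => [uzj|uzj].
  have [t e] : exists t, u z = u p + t * k.+1%:Z.
    by apply: residue_eqP; rewrite uj.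
  by case: zi; rewrite -periodic_shift // in e; rewrite (iu _ _ e) residue_shift.
case: (residue k z =P ordS i) => [zi'|zi'].
  have [t ->] : exists t, z = p + 1 + t * k.+1%:Z.
    by apply: residue_eqP; rewrite residueS pi.
  rewrite !periodic_shift // residue_shift up residueS uj eqxx.
  have -> : p + 1 + t * k.+1%:Z - 1 = p + t * k.+1%:Z by lia.
  by rewrite periodic_shift //; lia.
case: (residue k (u z) =P ordS j) => [uzj'|//].
have [t e] : exists t, u z = u (p + 1) + t * k.+1%:Z.
  by apply: residue_eqP; rewrite up residueS uj.
case: zi'; rewrite -periodic_shift // in e.
by rewrite (iu _ _ e) residue_shift residueS pi.
Qed.

(** * Exchange property and reduced words *)

Lemma exchange (k : nat) (w : seq 'I_k.+1) (p : int) : (1 <= k)%N ->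
  word_perm w (p + 1) < word_perm w p ->
  exists v : seq 'I_k.+1, (size v).+1 = size w /\
    word_perm v =1 word_perm w \o affine_refl (residue k p).
Proof.
move=> hk; elim: w => [|m w IH] /=; first by rewrite /=; lia.
set u := word_perm w => h.
case: (ltrP (u (p + 1)) (u p)) => [lt|le].
  have [v [sv pv]] := IH lt.
  by exists (m :: v); split=> [|z] /=; rewrite ?sv // pv.
have iu : injective u by exact: word_perm_inj.
have lt : u p < u (p + 1).
  rewrite lt_neqAle le andbT; apply/eqP => /iu; lia.
have [um up] := affine_refl_flip lt h.
(* The letter [m] reverses the images of p and p + 1, so s_m u = u s_p by conjugation; this is the
   letter to delete. *)
exists w; split=> // z /=.
have := affine_refl_conj (@word_perm_periodic k w) iu (erefl _) um up.
by move=> /(_ (affine_refl (residue k p) z)) /=; rewrite affine_reflK // => ->.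
Qed.

Definition reduced (k : nat) (w : seq 'I_k.+1) : Prop :=
  reduced_word (word_perm w) w.

Lemma reduced_wordE (k : nat) (x : int -> int) (w : seq 'I_k.+1) :
  reduced_word x w <-> word_perm w =1 x /\ reduced w.
Proof.
split=> [[e h]|[e [_ h]]].
  by split=> //; split=> // v ev; apply: h => z; rewrite ev.
by split=> // v ev; apply: h => z; rewrite ev e.
Qed.

Lemma reduced_eq (k : nat) (u v : seq 'I_k.+1) :
  reduced u -> reduced v -> word_perm u =1 word_perm v -> size u = size v.
Proof.
move=> [_ hu] [_ hv] e; apply/eqP; rewrite eqn_leq; apply/andP.
by rewrite hu // hv.
Qed.

Lemma reduced_same (k : nat) (u v : seq 'I_k.+1) :
  reduced u -> word_perm u =1 word_perm v -> size u = size v -> reduced v.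
Proof.
move=> [_ hu] e s; split=> // t et; rewrite -s; apply: hu => z.
by rewrite et e.
Qed.

Lemma reduced_catl (k : nat) (u v : seq 'I_k.+1) : reduced (u ++ v) -> reduced u.
Proof.
move=> [_ h]; split=> // t et; rewrite -(leq_add2r (size v)) -!size_cat.
by apply: h => z; rewrite !word_perm_cat /= et.
Qed.

Lemma reduced_catr (k : nat) (u v : seq 'I_k.+1) : reduced (u ++ v) -> reduced v.
Proof.
move=> [_ h]; split=> // t et; rewrite -(leq_add2l (size u)) -!size_cat.
by apply: h => z; rewrite !word_perm_cat /= et.
Qed.

Lemma reduced_rcons (k : nat) (w : seq 'I_k.+1) (i : 'I_k.+1) : (1 <= k)%N ->
  reduced (rcons w i) <->
  reduced w /\ word_perm w i%:Z < word_perm w (i%:Z + 1).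
Proof.
move=> hk; set y := word_perm w; split=> [h|[rw lt]].
  split; first by move: h; rewrite -cats1; exact: reduced_catl.
  case: (ltrP (y i%:Z) (y (i%:Z + 1))) => // le.
  have lt : y (i%:Z + 1) < y i%:Z.
    by rewrite lt_neqAle le andbT; apply/eqP => /(word_perm_inj hk); lia.
  have [v [sv pv]] := exchange hk lt.
  have := h.2 v; rewrite size_rcons -sv => le'.
  (* A descent of [w] at i gives a word for w s_i two letters shorter than [rcons w i]. *)
  suff : ((size v).+2 <= size v)%N by lia.
  by apply: le' => z; rewrite pv word_perm_rcons residue_ord.
split=> // v ev; rewrite size_rcons.
(* Any word [v] for w s_i has a descent at i; deleting a letter leaves a word for [w], which is no
   shorter than [w]. *)
have [|t [<- pt]] := @exchange _ v i%:Z hk.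
  rewrite !ev !word_perm_rcons /= !affine_reflE residueS residue_ord eqxx.
  by rewrite (negPf (ordS_neq i hk)) eqxx addrK.
rewrite ltnS; apply: rw.2 => z; rewrite pt /= ev word_perm_rcons /= residue_ord.
by rewrite affine_reflK.
Qed.

(** * Soundness of the nil-Coxeter relations *)

Definition nil_reduced (k : nat) (u : word0 k) : Prop :=
  if u is Some w then reduced w else False.

(** The value at zero is a default: permutations are compared only for reduced words. *)
Definition nil_perm (k : nat) (u : word0 k) : int -> int :=
  if u is Some w then word_perm w else id.

(** Zero counts as not reduced, so the square relation also preserves reducedness; the other
    relations preserve both length and permutation. *)
Lemma nil_eq_sound (k : nat) (u v : word0 k) : (1 <= k)%N -> nil_eq u v ->
  (nil_reduced u <-> nil_reduced v) /\
  (nil_reduced u -> nil_perm u =1 nil_perm v).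
Proof.
move=> hk; elim=> {u v}.
- by move=> u; split.
- move=> u v _ [e h]; split=> [|/e/h hv z]; [by split=> /e | by rewrite hv].
- move=> u v w _ [e1 h1] _ [e2 h2]; split=> [|r z].
    by split=> [/e1/e2|/e2/e1].
  by rewrite (h1 r) h2 //; apply/e1.
- move=> u u' v v' _ [e1 h1] _ [e2 h2].
  (* The congruence case is symmetric in both pairs, so one direction suffices. *)
  suff H (a a' b b' : word0 k) : (nil_reduced a <-> nil_reduced a') ->
      (nil_reduced a -> nil_perm a =1 nil_perm a') ->
      (nil_reduced b <-> nil_reduced b') ->
      (nil_reduced b -> nil_perm b =1 nil_perm b') ->
      nil_reduced (mul0 a b) -> nil_reduced (mul0 a' b') /\
      nil_perm (mul0 a b) =1 nil_perm (mul0 a' b').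
    split; last by move=> r; have [] := H u u' v v' e1 h1 e2 h2 r.
    split=> r; first by have [] := H u u' v v' e1 h1 e2 h2 r.
    have [] // := H u' u v' v _ _ _ _ r; first by split=> /e1.
    + by move=> /e1/h1 h z; rewrite h.
    + by split=> /e2.
    + by move=> /e2/h2 h z; rewrite h.
  case: a b => [a|] [b|] //= ea ha eb hb r.
  (* Factors of a reduced word are reduced, so replacing them keeps both their lengths and their
     permutations. *)
  have ra := reduced_catl r; have rb := reduced_catr r.
  case: a' ea ha => [a'|] /= ea ha; last by case: (ea.1 ra).
  case: b' eb hb => [b'|] /= eb hb; last by case: (eb.1 rb).
  have e : word_perm (a ++ b) =1 word_perm (a' ++ b').
    by move=> z; rewrite !word_perm_cat /= ha // hb.
  split=> //; apply: reduced_same r e _.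
  rewrite !size_cat (reduced_eq ra (ea.1 ra) (ha ra)).
  by rewrite (reduced_eq rb (eb.1 rb) (hb rb)).
- move=> i; split=> //=; last first.
    by move=> r z /=; rewrite affine_reflK.
  split=> // -[_ h]; suff : (2 <= 0)%N by [].
  by apply: (h [::]) => z /=; rewrite affine_reflK.
- move=> i j ij /=.
  have e : word_perm [:: i; j] =1 word_perm [:: j; i].
    have [ip [ii iS]] : i != ordS j /\ i != j /\ ordS i != j.
      move: ij; rewrite !inE !negb_or => /and3P[ip ii iS].
      by split; [rewrite -[i]ord_predK (inj_eq (@ordS_inj _)) |];
        rewrite !(eq_sym _ j).
    (* s_j fixes i and i + 1, so conjugation by s_j fixes s_i. *)
    have ri : affine_refl j i%:Z = i%:Z.
      by rewrite affine_reflE residue_ord (negPf ii) (negPf ip).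
    have ri1 : affine_refl j (i%:Z + 1) = i%:Z + 1.
      rewrite affine_reflE residueS residue_ord (negPf iS).
      by rewrite (inj_eq (@ordS_inj _)) (negPf ii).
    apply: (@affine_refl_conj k i i (affine_refl j) i%:Z).
    - exact: affine_refl_periodic.
    - exact: inv_inj (affine_reflK _ hk).
    - exact: residue_ord.
    - by rewrite ri residue_ord.
    - by rewrite ri ri1.
  split=> //; split=> r; apply: reduced_same r _ _ => //.
- move=> i hk2 /=.
  have e : word_perm [:: i; ordS i; i] =1 word_perm [:: ordS i; i; ordS i].
    (* The map s_i s_{i+1} sends i to i + 1 and i + 1 to i + 2, so it conjugates s_i into s_{i+1}:
       this is the braid relation. *)
    have e1 p : residue k p = i -> affine_refl i (affine_refl (ordS i) p) = p + 1.
      move=> pi; rewrite (affine_reflE (ordS i)) pi eq_sym (negPf (ordS_neq i hk)).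
      by rewrite eq_sym (negPf (ordSS_neq i hk2)) affine_reflE pi eqxx.
    move=> z; symmetry.
    apply: (@affine_refl_conj k i (ordS i)
      (affine_refl i \o affine_refl (ordS i)) i%:Z).
    - by move=> y /=; rewrite !affine_refl_periodic.
    - by apply: inj_comp; exact: inv_inj (affine_reflK _ hk).
    - exact: residue_ord.
    - by rewrite /= (e1 _ (residue_ord i)) residueS residue_ord.
    - rewrite /= (e1 _ (residue_ord i)) (affine_reflE (ordS i)).
      rewrite residueS residue_ord eqxx.
      rewrite affine_reflE !residueS residue_ord (negPf (ordSS_neq i hk2)).
      by rewrite (inj_eq (@ordS_inj _)) (negPf (ordS_neq i hk)).
  split=> //; split=> r; apply: reduced_same r _ _ => //.
Qed.

Lemma cyc_productE (k : nat) (s : seq {set 'I_k.+1}) :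
  \big[@mul0 k/Some [::]]_(A <- s) cyc_elt A =
  Some (flatten [seq cyc_word A | A <- s]).
Proof. by elim: s => [|A s IH]; rewrite ?big_nil ?big_cons ?IH. Qed.

(** * Removing letters from the right at descents *)

Lemma reduced_word_rcons (k : nat) (x : int -> int) (w : seq 'I_k.+1)
    (i : 'I_k.+1) : (1 <= k)%N ->
  reduced_word x (rcons w i) <->
  reduced_word (x \o affine_refl i) w /\ x (i%:Z + 1) < x i%:Z.
Proof.
move=> hk.
have ri : affine_refl i i%:Z = i%:Z + 1 by rewrite affine_reflE residue_ord eqxx.
have ri1 : affine_refl i (i%:Z + 1) = i%:Z by rewrite -ri affine_reflK.
split=> [/reduced_wordE[e /(reduced_rcons _ _ hk)[rw lt]]|].
  have e' : word_perm w =1 x \o affine_refl i.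
    by move=> z /=; rewrite -e word_perm_rcons /= affine_reflK.
  split; first exact/reduced_wordE.
  by move: lt; rewrite !e' /= ri ri1.
case=> /reduced_wordE[e rw] lt; apply/reduced_wordE; split.
  by move=> z; rewrite word_perm_rcons /= e /= affine_reflK.
by apply/(reduced_rcons _ _ hk); split=> //; rewrite !e /= ri ri1.
Qed.

(** The letters of [v] are stripped from the right of x in this order, each at a descent; hence
    [rev v] is the suffix removed. *)
Fixpoint removable (k : nat) (x : int -> int) (v : seq 'I_k.+1) : bool :=
  if v is i :: v' then
    (x (i%:Z + 1) < x i%:Z) && removable (x \o affine_refl i) v'
  else true.

Lemma reduced_word_removable (k : nat) (x : int -> int) (w v : seq 'I_k.+1) :
  (1 <= k)%N ->
  reduced_word x (w ++ rev v) <->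
  reduced_word (x \o word_perm v) w /\ removable x v.
Proof.
move=> hk; elim: v x => [|i v IH] x /=; first by rewrite cats0; split=> [|[]].
rewrite rev_cons -rcons_cat; split.
  by move=> /(reduced_word_rcons _ _ _ hk)[/IH[rw ->] ->].
by case=> rw /andP[lt rv]; apply/(reduced_word_rcons _ _ _ hk); split=> //; apply/IH.
Qed.

Lemma reduced_word_nil (k : nat) (x : int -> int) :
  reduced_word x ([::] : seq 'I_k.+1) <-> x =1 id.
Proof. by split=> [[e _] z|e]; [rewrite -e | split=> [z|//]; rewrite e]. Qed.

(** * Displacements and existence of reduced words *)

Definition displacement (x : int -> int) (z : int) : int := x z - z.

(** The normalisation of the sum becomes vanishing total displacement over the window 0, ..., k,
    which matches the indices in ['I_k.+1]. *)
Definition balanced (k : nat) (x : int -> int) : Prop :=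
  [/\ injective x, periodic k x
    & \sum_(j < k.+1) displacement x j%:Z = 0].

Lemma affine_perm_balanced (k : nat) (x : int -> int) :
  affine_perm k x -> balanced k x.
Proof.
move=> [bx px sx]; split=> //; first exact: bij_inj.
rewrite /displacement sumrB; apply/eqP; rewrite subr_eq0; apply/eqP.
rewrite -(big_mkord xpredT (fun j => x j%:Z)) -(big_mkord xpredT (fun j => j%:Z)).
have sj : \sum_(0 <= j < k.+2) j%:Z = ('C(k.+2, 2))%:Z.
  by rewrite -(big_morph Posz PoszD (erefl _)) bin2_sum.
move: sj sx; rewrite big_nat_recr //= => sj.
(* Passing from the window 1, ..., k + 1 to 0, ..., k replaces x(k+1) = x(0) + k + 1 by x(0), and
   the sum of the indices also drops by k + 1. *)
rewrite big_nat_recr //= -[k.+1%:Z]add0r px.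
rewrite [\sum_(0 <= i < k.+1) x i]big_nat_recl //.
rewrite -(big_add1 _ _ 0 k.+1 xpredT (fun i => x i%:Z)).
move=> sx; apply: (@addIr _ k.+1%:Z).
by rewrite sj -sx addrCA addrA.
Qed.

Lemma displacement_residue (k : nat) (x : int -> int) (z : int) :
  periodic k x -> displacement x (residue k z)%:Z = displacement x z.
Proof.
move=> px; have [t e] : exists t, z = (residue k z)%:Z + t * k.+1%:Z.
  by apply: residue_eqP; rewrite residue_ord.
by rewrite /displacement [in RHS]e periodic_shift //; lia.
Qed.

(** Only the displacements at i and i + 1 change, to d' + 1 and d - 1. Taking F the identity
    preserves [balanced]; taking F the square gives a decreasing measure. *)
Lemma sum_displacement_refl (k : nat) (x F : int -> int) (i : 'I_k.+1) :
  (1 <= k)%N -> periodic k x ->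
  let d := displacement x i%:Z in let d' := displacement x (i%:Z + 1) in
  \sum_(j < k.+1) F (displacement (x \o affine_refl i) j%:Z) =
  \sum_(j < k.+1) F (displacement x j%:Z)
  + (F (d' + 1) + F (d - 1) - F d - F d').
Proof.
move=> hk px d d'.
(* [ordS i] may wrap round to 0, but the displacement depends only on the residue. *)
have Sd : displacement x (ordS i)%:Z = d'.
  by rewrite -[i in LHS]residue_ord -residueS displacement_residue.
have e (j : 'I_k.+1) : displacement (x \o affine_refl i) j%:Z =
    if j == i then d' + 1 else if j == ordS i then d - 1
    else displacement x j%:Z.
  rewrite {1}/displacement /= affine_reflE residue_ord.
  case: eqP => [->|_]; first by rewrite /d' /displacement; lia.
  case: eqP => [ji|//]; rewrite -[x _](subrK (j%:Z - 1)) -/(displacement x _).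
  by rewrite -(displacement_residue _ px) residue_pred residue_ord ji ordSK /d; lia.
have split (G : 'I_k.+1 -> int) : \sum_j G j =
    G i + (G (ordS i) + \sum_(j | (j != i) && (j != ordS i)) G j).
  by rewrite (bigD1 i) //= (bigD1 (ordS i)) ?ordS_neq.
rewrite !split !e eqxx (negPf (ordS_neq i hk)) eqxx Sd -/d.
rewrite (eq_bigr (fun j : 'I_k.+1 => F (displacement x j%:Z))); first by ring.
by move=> j /andP[/negPf ji /negPf ji']; rewrite e ji ji'.
Qed.

Lemma balanced_refl (k : nat) (x : int -> int) (i : 'I_k.+1) :
  (1 <= k)%N -> balanced k x -> balanced k (x \o affine_refl i).
Proof.
move=> hk [ix px sx]; split.
- by apply: inj_comp => //; exact: inv_inj (affine_reflK _ hk).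
- by move=> z /=; rewrite affine_refl_periodic px.
- by rewrite (@sum_displacement_refl k x id) // sx; lia.
Qed.

Lemma balanced_word (k : nat) (x : int -> int) (v : seq 'I_k.+1) :
  (1 <= k)%N -> balanced k x -> balanced k (x \o word_perm v).
Proof.
move=> hk; elim: v x => [|i v IH] x bx //.
exact/(IH (x \o affine_refl i))/balanced_refl.
Qed.

(** An increasing integer map has weakly increasing displacement; periodicity makes it constant, and
    the zero sum makes it zero. *)
Lemma balanced_increasing (k : nat) (x : int -> int) : balanced k x ->
  (forall z : int, x z < x (z + 1)) -> x =1 id.
Proof.
move=> [ix px sx] inc.
have mono (z : int) (m : nat) : displacement x z <= displacement x (z + m%:Z).
  elim: m => [|m IH]; first by rewrite addr0.
  apply: (le_trans IH); have := inc (z + m%:Z); rewrite /displacement.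
  have -> : z + m.+1%:Z = z + m%:Z + 1 by lia.
  lia.
have const (m : nat) : (m <= k.+1)%N -> displacement x m%:Z = displacement x 0.
  move=> mk; have := mono 0 m; have := mono m%:Z (k.+1 - m)%N.
  rewrite -PoszD subnKC // add0r.
  by have := px 0; rewrite /displacement add0r; lia.
move: sx; rewrite (eq_bigr (fun _ => displacement x 0)); last first.
  by move=> j _; rewrite const // ltnW.
rewrite sumr_const card_ord => /eqP; rewrite mulrn_eq0 /= => /eqP d0 z.
have := displacement_residue z px; rewrite const 1?ltnW // d0.
by rewrite /displacement; lia.
Qed.

Lemma descent_or_id (k : nat) (x : int -> int) : balanced k x ->
  (exists i : 'I_k.+1, x (i%:Z + 1) < x i%:Z) \/ x =1 id.
Proof.
move=> bx; have [ix px _] := bx.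
have [/existsP|] := boolP [exists i : 'I_k.+1, x (i%:Z + 1) < x i%:Z]; first by left.
rewrite negb_exists => /forallP h; right; apply: (balanced_increasing bx) => z.
have [i [t ->]] : exists (i : 'I_k.+1) (t : int), z = i%:Z + t * k.+1%:Z.
  by exists (residue k z); apply: residue_eqP; rewrite residue_ord.
have ne : x i%:Z != x (i%:Z + 1) by apply/eqP => /ix; lia.
have := h i; rewrite -leNgt addrAC !periodic_shift //.
by rewrite le_eqVlt (negPf ne) /= ltrD2r.
Qed.

(* A descent x(i) > x(i+1) strictly decreases the sum of squared displacements
   when the two values are exchanged. *)
Lemma reduced_word_exists (k : nat) (x : int -> int) : (1 <= k)%N ->
  balanced k x -> exists w : seq 'I_k.+1, reduced_word x w.
Proof.
move=> hk.
have [m] := ubnP `|(\sum_(j < k.+1) (displacement x j%:Z) ^+ 2)%R|%N.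
elim: m x => // m IH x lm bx; have [ix px _] := bx.
case: (descent_or_id bx) => [[i lt]|xid]; last first.
  by exists [::]; apply/reduced_word_nil.
have [||w rw] := IH (x \o affine_refl i); last first.
- by exists (rcons w i); apply/(reduced_word_rcons _ _ _ hk).
- exact: balanced_refl.
move: lm; rewrite (sum_displacement_refl (fun z => z ^+ 2)) //.
have : 0 <= \sum_(j < k.+1) (displacement (x \o affine_refl i) j%:Z) ^+ 2.
  by apply: sumr_ge0 => j _; exact: sqr_ge0.
rewrite (sum_displacement_refl (fun z => z ^+ 2)) //=.
set S := \sum_(j < _) _; set d := displacement x i%:Z; set d' := displacement x _.
(* The sum of squares changes by 2(d' + 1 - d), which is negative at a descent. *)
have : d' + 1 < d by move: lt; rewrite /d /d' /displacement; lia.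
nia.
Qed.

(** * Removing reversed cyclically decreasing words *)

Fixpoint increasing_word (k : nat) (v : seq 'I_k.+1) : bool :=
  if v is i :: v' then
    [&& i \notin v', ord_pred i \notin v' & increasing_word v']
  else true.

Lemma cyc_decreasing_rev (k : nat) (A : {set 'I_k.+1}) (w : seq 'I_k.+1) :
  cyc_decreasing A w -> increasing_word (rev w).
Proof.
case/andP=> pw /forall_inP h.
have uw : uniq w by rewrite (perm_uniq pw) enum_uniq.
have {}h j : j \in w -> ord_pred j \in w -> (index j w < index (ord_pred j) w)%N.
  by rewrite !(perm_mem pw) !mem_enum => jA pA; exact: (implyP (h j jA)).
move: uw h; elim/last_ind: w {pw} => [|w i IH] //; rewrite rcons_uniq rev_rcons /=.
rewrite !mem_rev => /andP[iw uw] h; rewrite iw /= IH // => [|j jw pjw].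
  rewrite andbT; apply/negP => pi.
  have := h i; rewrite !mem_rcons !inE eqxx pi orbT => /(_ isT isT).
  by rewrite -cats1 !index_cat pi (negPf iw) /= eqxx addn0 ltnNge ltnW // index_mem.
have := h j; rewrite !mem_rcons !inE jw pjw !orbT => /(_ isT isT).
by rewrite -cats1 !index_cat jw pjw.
Qed.

(** The first letter i is a descent, so i + 1 is no record. For a later letter j, s_i fixes j + 1,
    and a larger value to its left for x s_i is carried back to x by s_i. *)
Lemma removable_nonrecord (k : nat) (x : int -> int) (v : seq 'I_k.+1)
    (j : 'I_k.+1) : increasing_word v -> removable x v -> j \in v ->
  exists2 q : int, q < j%:Z + 1 & x (j%:Z + 1) < x q.
Proof.
elim: v x => [|i v IH] x //= /and3P[iv piv cv] /andP[lt rv]; rewrite inE.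
case: (eqVneq j i) => [->|ji] /= jv; first by exists i%:Z => //; lia.
have jpi : j != ord_pred i by apply: contraNneq piv => <-.
have [q qj] := IH _ cv rv jv; rewrite /= => h; exists (affine_refl i q).
  rewrite affine_reflE; case: (residue k q =P i) => qi; last by case: eqP => _; lia.
  (* Moving up from q = j would reach j + 1 itself; this is excluded since j differs from i. *)
  have : q != j%:Z by apply: contraNneq ji => qj'; rewrite -qi qj' residue_ord.
  by move=> ne; lia.
move: h; rewrite (affine_reflE i (_ + 1)) residueS residue_ord.
rewrite (can2_eq (@ordSK _) (@ord_predK _)) (negPf jpi).
by rewrite (inj_eq (@ordS_inj _)) (negPf ji).
Qed.

(** Here p starts a run of [v] and q goes up to one past its end: the value at p exceeds every value
    it has to pass. *)
Definition run_maximal (k : nat) (x : int -> int) (v : seq 'I_k.+1) : Prop :=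
  forall p q : int, p < q -> residue k (p - 1) \notin v ->
    (forall m : int, p <= m < q -> residue k m \in v) -> x q < x p.

(** The first letter i starts a run, so it is a descent. Removing it carries x(i) to i + 1, where
    the rest of the run starts, so the condition persists. *)
Lemma run_maximal_removable (k : nat) (x : int -> int) (v : seq 'I_k.+1) :
  (1 <= k)%N -> increasing_word v -> run_maximal x v -> removable x v.
Proof.
move=> hk; elim: v x => [|i v IH] x //= /and3P[iv piv cv] rx.
have pii : ord_pred i != i.
  by rewrite -(inj_eq (@ordS_inj _)) ord_predK eq_sym ordS_neq.
apply/andP; split.
  apply: rx; first by lia.
    by rewrite residue_pred residue_ord inE negb_or pii.
  move=> m /andP[m1 m2]; have -> : m = i%:Z by lia.
  by rewrite residue_ord mem_head.
apply: IH => // p q pq p1 run /=.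
have notin m : residue k m \in v -> residue k m != i /\ residue k m != ord_pred i.
  by move=> mv; split; [apply: contraNneq iv | apply: contraNneq piv] => <-.
(* q - 1 lies in the tail [v], which contains neither i nor i - 1. *)
have rq : affine_refl i q = q.
  have [|qi qi'] := notin (q - 1); first by apply: run; lia.
  rewrite affine_reflE -[q](subrK 1) residueS.
  rewrite (can2_eq (@ordSK _) (@ord_predK _)) (inj_eq (@ordS_inj _)).
  by rewrite (negPf qi) (negPf qi').
have [pi _] : residue k p != i /\ residue k p != ord_pred i.
  by apply: notin; apply: run; lia.
rewrite rq affine_reflE (negPf pi) -{1}[p](subrK 1) residueS (inj_eq (@ordS_inj _)).
(* If p - 1 has residue i, then p now carries x(p-1), and the old run started at p - 1; otherwise
   the run at p is an old one. *)
have [p1i|p1i] := eqVneq; last first.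
  apply: rx => // [|m mpq]; first by rewrite inE negb_or p1i.
  by rewrite inE run ?orbT.
apply: rx => [||m mpq]; first by lia.
  by rewrite residue_pred p1i inE negb_or pii.
rewrite inE; have [->|mp] := eqVneq m (p - 1); first by rewrite p1i eqxx.
by rewrite run ?orbT //; lia.
Qed.

(** * Records and the maximal right factor *)

Definition is_record (k : nat) (x : int -> int) (r : int) : bool :=
  [forall i : 'I_k.+1, x (r - 1 - i%:Z) < x r].

(** Every q < r lies a nonnegative number of periods below one of the k + 1 tested positions, and
    such a shift only lowers the value. *)
Lemma is_recordP (k : nat) (x : int -> int) (r : int) : periodic k x ->
  reflect (forall q : int, q < r -> x q < x r) (is_record k x r).
Proof.
move=> px; apply: (iffP forallP) => [h q qr|h i]; last by apply: h; lia.
have := h (residue k (r - 1 - q)); rewrite residue_val => lt.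
have e := divz_eq (r - 1 - q) k.+1%:Z.
have t0 : 0 <= ((r - 1 - q) %/ k.+1%:Z)%Z by rewrite divz_ge0 //; lia.
set t := (_ %/ _)%Z in e t0; set m := (_ %% _)%Z in lt e.
have qE : q = r - 1 - m + (- t) * k.+1%:Z by rewrite mulNr; lia.
by rewrite qE periodic_shift // mulNr; nia.
Qed.

Lemma not_recordP (k : nat) (x : int -> int) (r : int) : periodic k x ->
  injective x ->
  reflect (exists2 q : int, q < r & x r < x q) (~~ is_record k x r).
Proof.
move=> px ix; apply: (iffP idP) => [|[q qr lt]]; last first.
  by apply/negP => /(is_recordP _ px)/(_ q qr); rewrite ltNge ltW.
rewrite negb_forall => /existsP[i]; rewrite -leNgt le_eqVlt => /orP[/eqP/ix|lt].
  by lia.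
by exists (r - 1 - i%:Z) => //; lia.
Qed.

Lemma is_record_shift (k : nat) (x : int -> int) (r t : int) : periodic k x ->
  is_record k x (r + t * k.+1%:Z) = is_record k x r.
Proof.
move=> px; apply: eq_forallb => i; rewrite periodic_shift //.
have -> : r + t * k.+1%:Z - 1 - i%:Z = r - 1 - i%:Z + t * k.+1%:Z by lia.
by rewrite periodic_shift // ltrD2r.
Qed.

Definition max_set (k : nat) (x : int -> int) : {set 'I_k.+1} :=
  [set j : 'I_k.+1 | ~~ is_record k x (j%:Z + 1)].

Lemma mem_max_set (k : nat) (x : int -> int) (z : int) : periodic k x ->
  (residue k z \in max_set k x) = ~~ is_record k x (z + 1).
Proof.
move=> px; rewrite inE.
have [t e] : exists t, z = (residue k z)%:Z + t * k.+1%:Z.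
  by apply: residue_eqP; rewrite residue_ord.
by rewrite [in RHS]e addrAC is_record_shift.
Qed.

(** The position j of the maximum over 0, ..., k is a record: a larger value can occur only at least
    one full period above the window, hence to the right of j. *)
Lemma max_set_proper (k : nat) (x : int -> int) : periodic k x -> injective x ->
  max_set k x != setT.
Proof.
move=> px ix; apply/negP => /eqP mT.
have [j _ jmax] := @arg_maxP _ _ _ ord0 xpredT (fun j : 'I_k.+1 => x j%:Z) isT.
have : residue k (j%:Z - 1) \in max_set k x by rewrite mT inE.
rewrite mem_max_set // subrK => /(not_recordP _ px ix)[q qj lt].
have [t e] : exists t, q = (residue k q)%:Z + t * k.+1%:Z.
  by apply: residue_eqP; rewrite residue_ord.
have := jmax (residue k q) isT; move: lt qj; rewrite [in x q]e periodic_shift //.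
move=> lt qj jm; have tn : 0 < t * k.+1%:Z.
  by rewrite -(ltrD2l (x (residue k q)%:Z)) addr0; exact: le_lt_trans jm lt.
have t1 : 1 <= t by move: tn; rewrite pmulr_lgt0.
have : k.+1%:Z <= t * k.+1%:Z by rewrite ler_peMl.
by have := ltn_ord j; lia.
Qed.

Lemma max_set_run_maximal (k : nat) (x : int -> int) (v : seq 'I_k.+1) :
  periodic k x -> injective x -> v =i max_set k x -> run_maximal x v.
Proof.
move=> px ix vE p q pq; rewrite vE mem_max_set // subrK negbK.
move=> /(is_recordP _ px) rp run.
have [N] := ubnP `|q - p|%N.
elim: N q pq run => // N IH q pq run qN.
have : residue k (q - 1) \in max_set k x by rewrite -vE; apply: run; lia.
rewrite mem_max_set // subrK => /(not_recordP _ px ix)[r rq lt].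
(* The larger value at r < q is bounded by the record at p if r is at most p, and by induction on q
   - p otherwise. *)
case: (ltrP p r) => pr; last first.
  apply: (lt_le_trans lt); move: pr; rewrite le_eqVlt => /orP[/eqP-> //|/rp/ltW //].
apply: (lt_trans lt); apply: IH => //; last by lia.
by move=> m mr; apply: run; lia.
Qed.

Lemma max_set_id (k : nat) (x : int -> int) : balanced k x ->
  max_set k x = set0 -> x =1 id.
Proof.
move=> bx m0; have [_ px _] := bx; apply: (balanced_increasing bx) => z.
have : residue k z \notin max_set k x by rewrite m0 inE.
by rewrite mem_max_set // negbK => /(is_recordP _ px); apply; lia.
Qed.

Lemma removable_cyc_word_sub (k : nat) (x : int -> int) (A : {set 'I_k.+1}) :
  balanced k x -> A != setT -> removable x (rev (cyc_word A)) ->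
  A \subset max_set k x.
Proof.
move=> [ix px _] AT rA; have cA := cyc_wordP AT; apply/subsetP => j jA.
rewrite -[j]residue_ord mem_max_set //; apply/not_recordP => //.
apply: removable_nonrecord rA _; first exact: cyc_decreasing_rev cA.
by case/andP: cA => pA _; rewrite mem_rev (perm_mem pA) mem_enum.
Qed.

Lemma removable_max_set (k : nat) (x : int -> int) : (1 <= k)%N ->
  balanced k x -> removable x (rev (cyc_word (max_set k x))).
Proof.
move=> hk [ix px _]; have cA := cyc_wordP (max_set_proper px ix).
apply: run_maximal_removable => //; first exact: cyc_decreasing_rev cA.
apply: max_set_run_maximal => // j.
by case/andP: cA => pA _; rewrite mem_rev (perm_mem pA) mem_enum.
Qed.

(** * Decompositions and the greedy choice *)

Definition reduced_decomposition (k : nat) (x : int -> int)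
    (s : seq {set 'I_k.+1}) : Prop :=
  all (fun A : {set 'I_k.+1} => (A != set0) && (A != setT)) s /\
  reduced_word x (flatten [seq cyc_word A | A <- rev s]).

Lemma cyc_decompositionE (k : nat) (x : int -> int) (s : seq {set 'I_k.+1}) :
  (1 <= k)%N ->
  cyc_decomposition x s <-> reduced_decomposition x s.
Proof.
move=> hk; rewrite /cyc_decomposition /reduced_decomposition cyc_productE.
split=> -[ok h]; split=> //; last by exists (flatten [seq cyc_word A | A <- rev s]);
  split=> //; exact: nil_eq_refl.
have [w [/reduced_wordE[ew rw] /(nil_eq_sound hk) /= [e1 e2]]] := h.
by apply/reduced_wordE; split; [move=> z; rewrite -e2 // ew | exact/e1].
Qed.

(** The first set of the sequence is the rightmost factor, so its letters are stripped first. *)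
Lemma reduced_decomposition_cons (k : nat) (x : int -> int)
    (A : {set 'I_k.+1}) (s : seq {set 'I_k.+1}) : (1 <= k)%N ->
  reduced_decomposition x (A :: s) <->
  [/\ A != set0, A != setT, removable x (rev (cyc_word A))
    & reduced_decomposition (x \o word_perm (rev (cyc_word A))) s].
Proof.
move=> hk; rewrite /reduced_decomposition /= rev_cons map_rcons flatten_rcons.
rewrite -{1}[cyc_word A]revK; split.
  by case=> /andP[/andP[-> ->] ->] /(reduced_word_removable _ _ _ hk)[].
by case=> -> -> rA [-> rs]; split=> //; apply/reduced_word_removable.
Qed.

Lemma size_cyc_word (k : nat) (A : {set 'I_k.+1}) :
  A != setT -> size (cyc_word A) = #|A|.
Proof. by move=> /cyc_wordP/andP[/perm_size-> _]; rewrite cardE. Qed.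

(** The clause on equal shapes is proved together with maximality, so that uniqueness follows from
    the same induction on length. *)
Lemma greedy_decomposition (k : nat) (x : int -> int) : (1 <= k)%N ->
  balanced k x ->
  exists s : seq {set 'I_k.+1}, reduced_decomposition x s /\
    forall t, reduced_decomposition x t ->
      (Defs.shape t <= Defs.shape s)%O /\ (Defs.shape t = Defs.shape s -> t = s).
Proof.
move=> hk bx; have [w rw] := reduced_word_exists hk bx.
have [m] := ubnP (size w); elim: m x w bx rw => // m IH x w bx rw lw.
have [ix px _] := bx; have MT := max_set_proper px ix.
have rM := removable_max_set hk bx.
have [M0|M0] := eqVneq (max_set k x) set0.
  have xid := max_set_id bx M0; exists [::]; split.
    by split=> //; exact/reduced_word_nil.
  case=> [|A t] // /(reduced_decomposition_cons _ _ _ hk)[A0 AT rA _].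
  case/negP: A0; rewrite -subset0 -M0; exact: removable_cyc_word_sub.
set M := max_set k x in MT rM M0; set x' := x \o word_perm (rev (cyc_word M)).
have bx' : balanced k x' by exact: balanced_word.
have [w' rw'] := reduced_word_exists hk bx'.
have rwM : reduced_word x (w' ++ cyc_word M).
  by rewrite -[cyc_word M]revK; apply/reduced_word_removable.
(* Stripping d_M shortens the reduced word by |M| > 0 letters. *)
have lw' : (size w' < m)%N.
  have := rwM.2 w rw.1; rewrite size_cat size_cyc_word // => le.
  have : (0 < #|M|)%N by rewrite card_gt0.
  lia.
have [s [ds smax]] := IH x' w' bx' rw' lw'.
exists (M :: s); split; first exact/reduced_decomposition_cons.
case=> [|A t]; first by split.
case/(reduced_decomposition_cons _ _ _ hk)=> A0 AT rA dt.
have AM : A \subset M by exact: removable_cyc_word_sub.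
(* If A = M, the tails are compared by induction; otherwise |A| < |M| decides the order at the first
   entry. *)
have [AE|AM'] := eqVneq A M.
  subst A; have [le eq] := smax t dt; split; first by rewrite lexi_cons lexx.
  by case=> /eq->.
have lt : (#|A| < #|M|)%N by apply: proper_card; rewrite properEneq AM'.
split; first by rewrite lexi_cons leEnat ltnW //= leqNgt lt.
by case=> e; rewrite e ltnn in lt.
Qed.

Theorem theorem20 (k : nat) (hk : (1 <= k)%N) (x : int -> int)
    (hx : affine_perm k x) :
  exists! s : seq {set 'I_k.+1}, maximal_cyc_decomposition x s.
Proof.
have [s [ds smax]] := greedy_decomposition hk (affine_perm_balanced hx).
have decE (t : seq {set 'I_k.+1}) :
    cyc_decomposition x t <-> reduced_decomposition x t.
  exact: (cyc_decompositionE x t hk).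
exists s; split.
  by split=> [|t /decE/smax[]]; first exact/decE.
(* Two maximal decompositions bound each other's shapes; equal shapes then force equality. *)
move=> t [/decE dt tmax]; have [le eq] := smax t dt.
by symmetry; apply: eq; apply: le_anti; rewrite le tmax //; exact/decE.
Qed.
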